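(* Let $\alpha,\beta,\kappa$ be cardinals with $\omega\le\kappa\le\beta\le 2^\alpha$. Then $d\big(((D(\alpha))^\beta)_\kappa\big)=\alpha^{<\kappa}$.
   Context: $D(\alpha)$ is the discrete space of cardinality $\alpha$. $d(X)$ is the density character of $X$ (least cardinality of a dense subset). For a product $X_I=\prod_{i\in I}X_i$ of spaces (here a power with index set of cardinality $\beta$) and an infinite cardinal $\kappa$, $(X_I)_\kappa$ is the set $X_I$ with the $\kappa$-box topology, whose base consists of all sets $\prod_{i\in I}U_i$ with each $U_i$ open in $X_i$ and $|\{i\in I:U_i\ne X_i\}|<\kappa$. $\alpha^{<\kappa}:=\sum_{\lambda<\kappa}\alpha^\lambda$ (sum over cardinals $\lambda<\kappa$). *)

(* Defs.v *)
From HB Require Import structures.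
From mathcomp Require Import all_boot all_order all_algebra.
From mathcomp Require Import all_classical all_reals topology.

Set Implicit Arguments.
Unset Strict Implicit.
Unset Printing Implicit Defensive.

Local Open Scope classical_set_scope.
Local Open Scope card_scope.

(* Cardinals are represented by types (or sets) and compared with the
   relations [#<=] and [#=] of [cardinality]. *)

Definition card_lt T U (A : set T) (B : set U) : bool :=
  (A #<= B) && ~~ (B #<= A).
Notation "A '#<' B" := (card_lt A B)
  (at level 79, format "A  '#<'  B") : card_scope.

Lemma rel_card_le T U (A : set T) (B : set U) (G : T -> U -> Prop) :
  (forall a, A a -> exists2 b, B b & G a b) ->
  (forall a a' b, A a -> A a' -> G a b -> G a' b -> a = a') ->
  A #<= B.
Proof.
move=> GAB Ginj.
have /(_ _)/cid-/all_sig[f fP] : forall a : A, exists b : B, G (val a) (val b).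
  move=> [a /[dup] aA /set_mem Aa] /=; have [b Bb Gab] := GAB a Aa.
  by exists (SigSub (mem_set Bb)).
apply/card_leP/injfunPex; exists f => // a a' _ _ faa'.
apply: val_inj; apply: (Ginj _ _ (val (f a))).
- exact/set_mem/valP.
- exact/set_mem/valP.
- exact: fP.
- by rewrite faa'; exact: fP.
Qed.

Lemma card_le_rel T U (A : set T) (B : set U) : A #<= B ->
  exists G : T -> U -> Prop, (forall a, A a -> exists2 b, B b & G a b) /\
    (forall a a' b, A a -> A a' -> G a b -> G a' b -> a = a').
Proof.
move=> /card_leP/injfunPex[f _ fI].
exists (fun a b => exists aA bB, f (exist _ a aA) = exist _ b bB).
split=> [a Aa|a a' b Aa Aa' [aA [bB fab]] [a'A [b'B fa'b]]].
  case fa : (f (exist _ a (mem_set Aa))) => [b bB].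
  by exists b; [exact/set_mem | exists (mem_set Aa), bB].
suff: exist (fun x => x \in A) a aA = exist _ a' a'A by case.
apply: fI; rewrite ?in_setT// fab fa'b; congr exist; exact: Prop_irrelevance.
Qed.

Lemma card_le_total T U (A : set T) (B : set U) : A #<= B \/ B #<= A.
Proof.
pose P := [set G : set (T * U) | (forall p, G p -> A p.1 /\ B p.2) /\
  (forall p q, G p -> G q -> (p.1 = q.1 <-> p.2 = q.2))].
have [F FP Ftot|G [[GAB Ginj] Gmax]] := @Zorn_bigcup _ P.
  split=> [p [X FX Xp]|p q [X FX Xp] [Y FY Yq]]; first exact: (FP _ FX).1.
  have [XY|YX] := Ftot _ _ FX FY.
    by apply: (FP _ FY).2 => //; exact: XY.
  by apply: (FP _ FX).2 => //; exact: YX.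
have [GA|/existsNP[a /not_implyP[Aa nGa]]] :=
    pselect (forall a, A a -> exists b, G (a, b)).
  left; apply: (@rel_card_le _ _ _ _ (fun a b => G (a, b))).
    by move=> a /GA[b Gab]; exists b => //; exact: (GAB _ Gab).2.
  by move=> a a' b _ _ Gab Ga'b; apply/(Ginj _ _ Gab Ga'b).
have [GB|/existsNP[b /not_implyP[Bb nGb]]] :=
    pselect (forall b, B b -> exists a, G (a, b)).
  right; apply: (@rel_card_le _ _ _ _ (fun b a => G (a, b))).
    by move=> b /GB[c Gcb]; exists c => //; exact: (GAB _ Gcb).1.
  by move=> b b' c _ _ Gcb Gcb'; apply/(Ginj _ _ Gcb Gcb').
exfalso; apply: (Gmax ((a, b) |` G)).
  split; last by move=> /(_ (a, b))/(_ (or_introl erefl)) Gab; apply: nGb; exists a.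
  by move=> p Gp; right.
split=> [p [->//|]|]; first exact: GAB.
move=> [a1 b1] [a2 b2] [[-> ->]|G1] [[-> ->]|G2] //=.
- split=> [aa2|bb2].
    by exfalso; apply: nGa; exists b2; rewrite aa2.
  by exfalso; apply: nGb; exists a2; rewrite bb2.
- split=> [aa1|bb1].
    by exfalso; apply: nGa; exists b1; rewrite -aa1.
  by exfalso; apply: nGb; exists a1; rewrite -bb1.
- exact: (Ginj _ _ G1 G2).
Qed.

Lemma card_setX_bool T (A : set T) : infinite_set A ->
  A `*` [set: bool] #<= A.
Proof.
move=> Ainf.
pose dom (G : set (T * bool * T)) := [set x | exists b y, G (x, b, y)].
pose P := [set G : set (T * bool * T) |
  [/\ (forall x b y, G (x, b, y) -> A x /\ dom G y),
      (forall x b, dom G x -> exists y, G (x, b, y)) &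
      (forall p q, G p -> G q -> (p.1 = q.1 <-> p.2 = q.2))]].
have [F FP Ftot|G [[GA Gfun Ginj] Gmax]] := @Zorn_bigcup _ P.
  split.
  - move=> x b y [X FX Xp]; have [XA _ _] := FP _ FX.
    have [Ax [b' [y' Xy]]] := XA _ _ _ Xp.
    by split=> //; exists b', y', X.
  - move=> x b [b' [y' [X FX Xp]]]; have [_ Xf _] := FP _ FX.
    have [|y Xy] := Xf x b; first by exists b', y'.
    by exists y, X.
  - move=> p q [X FX Xp] [Y FY Yq]; have [XY|YX] := Ftot _ _ FX FY.
      by have [_ _ Yi] := FP _ FY; apply: Yi => //; exact: XY.
    by have [_ _ Xi] := FP _ FX; apply: Xi => //; exact: YX.
pose D := dom G.
have DA : D `<=` A by move=> x [b [y /GA[]]].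
have XD : D `*` [set: bool] #<= D.
  apply: (@rel_card_le _ _ _ _ (fun p y => G (p, y))).
    move=> [x b] [Dx _]; have [y Gy] := Gfun x b Dx.
    by exists y => //; exact: (GA _ _ _ Gy).2.
  by move=> p p' y _ _ Gp Gp'; apply/(Ginj _ _ Gp Gp').
have finAD : finite_set (A `\` D).
  apply: contrapT => /infiniteP.
  move=> /card_leP/injfunPex[f0 _ f0I].
  pose e n : T := val (f0 (SigSub (mem_set (I : [set: nat] n)))).
  have eI : injective e.
    by move=> m n /val_inj/f0I; rewrite !in_setT => /(_ isT isT) [].
  have eAD n : (A `\` D) (e n) by apply/set_mem; exact: valP.
  pose H := [set p : T * bool * T | exists n (b : bool),
    p = (e n, b, e (n.*2 + b)%N)].
  apply: (Gmax (G `|` H)).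
    split; first by move=> p; left.
    move=> /(_ (e 0%N, false, e 0%N)) GH; apply: (eAD 0%N).2.
    by exists false, (e 0%N); apply: GH; right; exists 0%N, false.
  have ndom n b y : ~ G (e n, b, y).
    by move=> Gn; apply: (eAD n).2; exists b, y.
  have ncod p n : ~ G (p, e n).
    by case: p => x b Gn; apply: (eAD n).2; exact: (GA _ _ _ Gn).2.
  have e2I m n (b c : bool) :
      (m.*2 + b)%N = (n.*2 + c)%N -> m = n /\ b = c.
    move=> mn; have bc : b = c.
      by move/(congr1 odd): mn; rewrite !oddD !odd_double !oddb.
    by split=> //; move: mn; rewrite bc => /addIn/double_inj.
  have domU x : dom (G `|` H) x <-> D x \/ exists n, x = e n.
    split.
      move=> [b [y [Gx|[n [c [-> _ _]]]]]]; first by left; exists b, y.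
      by right; exists n.
    move=> [[b [y Gx]]|[n ->]]; first by exists b, y; left.
    by exists false, (e (n.*2 + false)%N); right; exists n, false.
  split.
  - move=> x b y [/GA[Ax Dy]|[n [c [-> _ ->]]]].
      by split=> //; apply/domU; left.
    split; first exact: (eAD n).1.
    by apply/domU; right; eexists.
  - move=> x b /domU[/(Gfun x b)[y Gy]|[n ->]]; first by exists y; left.
    by exists (e (n.*2 + b)%N); right; exists n, b.
  - move=> p q [Gp|[m [b ->]]] [Gq|[n [c ->]]] /=.
    + exact: Ginj.
    + split=> pq.
        by case: p pq Gp => _ y /= -> /ndom.
      by case: p pq Gp => x y /= -> /ncod.
    + split=> pq.
        by case: q pq Gq => _ y /= <- /ndom.
      by case: q pq Gq => x y /= <- /ncod.
    + split; first by case=> /eI -> ->.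
      by move=> /eI/e2I[-> ->].
have infD : infinite_set D.
  move=> finD; apply: Ainf; rewrite -(setDUK DA).
  by rewrite finite_setU.
have ADD : A `\` D #<= D.
  apply: card_le_trans (finite_set_countable finAD) _.
  exact/infiniteP.
have AD : A #<= D `*` [set: bool].
  have [R [RD Rinj]] := card_le_rel ADD.
  apply: (@rel_card_le _ _ _ _ (fun a p =>
    (D a /\ p = (a, true)) \/ (~ D a /\ R a p.1 /\ p.2 = false))).
    move=> a Aa; have [Da|nDa] := pselect (D a).
      by exists (a, true) => //; left.
    have [|d Dd Rad] := RD a; first by split.
    by exists (d, false) => //; right.
  move=> a a' [d b] Aa Aa' [[Da [-> ->]]|[nDa [/= Ra ->]]] [[Da' []]|[nDa' [/= Ra' ]]] //.
  by move=> _; apply: Rinj Ra Ra'.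
have {}AD := card_le_trans AD XD.
apply: card_le_trans (subset_card_le DA).
apply: card_le_trans XD.
have [R [RD Rinj]] := card_le_rel AD.
apply: (@rel_card_le _ _ _ _ (fun p q => R p.1 q.1 /\ p.2 = q.2)).
  by move=> [a b] [/= /RD[d Dd Rad] _]; exists (d, b).
move=> [a b] [a' b'] [d c] [/= Aa _] [/= Aa' _] [Ra ->] [Ra' ->].
by rewrite (Rinj _ _ _ Aa Aa' Ra Ra').
Qed.

Lemma card_lt_setU T U (K : set U) (A B : set T) : infinite_set K ->
  A #< K -> B #< K -> A `|` B #< K.
Proof.
move=> Kinf; wlog AB : A B / A #<= B.
  move=> H AK BK; have [AB|BA] := card_le_total A B; first exact: H.
  by rewrite setUC; exact: H.
move=> _ BK; have [finB|infB] := pselect (finite_set B).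
  have finA := card_le_finite AB finB.
  have finAB : finite_set (A `|` B) by rewrite finite_setU.
  have KAB : ~~ (K #<= A `|` B).
    by apply/negP => /card_le_finite/(_ finAB).
  rewrite /card_lt KAB andbT.
  by have [//|] := card_le_total (A `|` B) K; rewrite (negPf KAB).
have ABB : A `|` B #<= B.
  apply: card_le_trans (card_setX_bool infB).
  have [R [RB Rinj]] := card_le_rel AB.
  apply: (@rel_card_le _ _ _ _ (fun a p =>
    (B a /\ p = (a, true)) \/ (~ B a /\ R a p.1 /\ p.2 = false))).
    move=> a ABa; have [Ba|nBa] := pselect (B a).
      by exists (a, true) => //; left.
    case: ABa => // /RB[b Bb Rab].
    by exists (b, false) => //; right.
  move=> a a' [d b] Aa Aa' [[Ba [-> ->]]|[nBa [/= Ra ->]]] [[Ba' []]|[nBa' [/= Ra' ]]] //.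
  by move=> _; case: Aa => // ?; case: Aa' => // ?; apply: Rinj Ra Ra'.
move/andP: BK => [BK nKB]; apply/andP; split; first exact: card_le_trans BK.
by apply: contra nKB => /card_le_trans; apply.
Qed.

(* The product of the [X i] with the [K]-box topology, [K] being an infinite
   cardinal.  Infiniteness is an argument since the boxes form a base only in
   that case. *)
Definition kbox_product (K : Type) (infK : [set: nat] #<= [set: K])
  (I : Type) (X : I -> Type) : Type := forall i, X i.

Section kbox_product.
Context (K : Type) (infK : [set: nat] #<= [set: K]).
Context (I : Type) (X : I -> topologicalType).

Definition kbox (U : forall i, set (X i)) : set (kbox_product infK X) :=
  [set f | forall i, U i (f i)].

Definition kbox_family : set (forall i, set (X i)) :=
  [set U | (forall i, open (U i)) /\ [set i | U i <> setT] #< [set: K]].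

Lemma kbox_cover : \bigcup_(U in kbox_family) kbox U = setT.
Proof.
apply/seteqP; split=> // f _; exists (fun=> setT) => //; split.
  by move=> i; exact: openT.
rewrite (_ : [set i | _] = set0); last by apply/seteqP; split=> i.
rewrite /card_lt card_ge0 card_le0 /=.
apply/eqP => K0; have /infiniteP := infK; apply; rewrite K0.
exact: finite_set0.
Qed.

Lemma kbox_join (U V : forall i, set (X i)) (f : kbox_product infK X) :
  kbox_family U -> kbox_family V -> kbox U f -> kbox V f ->
  exists W, [/\ kbox_family W, kbox W f & kbox W `<=` kbox U `&` kbox V].
Proof.
move=> [oU UK] [oV VK] Uf Vf; exists (fun i => U i `&` V i); split.
- split; first by move=> i; exact: openI.
  have UVK : [set i | U i <> setT] `|` [set i | V i <> setT] #< [set: K].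
    by apply: card_lt_setU => //; exact/infiniteP.
  rewrite (_ : [set i | _] = [set i | U i <> setT] `|` [set i | V i <> setT])//.
  apply/seteqP; split=> i /=.
    move=> nT; apply: contrapT => /not_orP[/contrapT UT /contrapT VT].
    by apply: nT; rewrite UT VT setTI.
  by move=> + UVT; move: UVT; rewrite -subTset subsetI !subTset => -[-> ->] [].
- by move=> i; split.
- by move=> g gW; split=> i; have [] := gW i.
Qed.

HB.instance Definition _ := Choice.on (kbox_product infK X).
HB.instance Definition _ := isBaseTopological.Build (kbox_product infK X)
  kbox_cover kbox_join.

Lemma kbox_openE (O : set (kbox_product infK X)) :
  open O <-> exists2 F, F `<=` kbox_family & \bigcup_(U in F) kbox U = O.
Proof. by []. Qed.

End kbox_product.

(* [d(X) = |C|] *)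
Definition is_density (X : topologicalType) T (C : set T) : Prop :=
  (exists2 D : set X, dense D & D #= C) /\
  (forall D : set X, dense D -> C #<= D).

(* The cardinals smaller than that of [K], encoded as the equipotence classes
   of subsets of [K] of smaller cardinality; [get c] is then a member of the
   class [c], i.e. a set whose cardinal is the one encoded by [c]. *)
Definition cardinals_lt (K : Type) : set (set (set K)) :=
  [set [set M : set K | M #= L] | L in [set L : set K | L #< [set: K]]].
Arguments cardinals_lt : clear implicits.

(* The disjoint union, over the cardinals [c] smaller than that of [K], of the
   sets of functions from (a set of cardinal) [c] to [A]. *)
Definition pow_lt (A K : Type) : Type :=
  {c : cardinals_lt K & (get (val c) : set K) -> A}.

Lemma get_cardinals_lt (K : Type) (c : cardinals_lt K) :
  (get (val c) : set K) #< [set: K] /\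
  val c = [set M : set K | M #= get (val c)].
Proof.
case: c => c /[dup] cK /set_mem [L LK cE] /=.
have gL : get c #= L.
  by rewrite -cE; apply: (@getPex _ [set M : set K | M #= L]); exists L; exact: card_eqxx.
split; last by rewrite -cE; apply/seteqP; split=> M /=; rewrite cE (card_eqr gL).
by move: LK; rewrite /= /card_lt (card_le_eql gL) (card_le_eqr gL).
Qed.

Lemma cardinals_lt_unique (K T : Type) (S : set T) : S #< [set: K] ->
  exists! c : cardinals_lt K, S #= (get (val c) : set K).
Proof.
move=> /andP[SK KS].
have /card_subP[L LS _] := SK.
have LK : L #< [set: K].
  by rewrite /card_lt (card_le_eql LS) SK (card_le_eqr LS) KS.
have cK : [set M : set K | M #= L] \in cardinals_lt K.
  by apply/mem_set; exists L.
have gE (c : cardinals_lt K) : S #= (get (val c) : set K) ->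
    val c = [set M : set K | M #= L].
  move=> Sc; have [_ ->] := get_cardinals_lt c.
  by apply/seteqP; split=> M /=; rewrite -(card_eqr Sc) (card_eqr LS).
exists (SigSub cK); split.
  have /= gL := @getPex _ [set M : set K | M #= L] (ex_intro _ L (card_eqxx L)).
  by rewrite (card_eqr gL) card_eq_sym.
by move=> c /gE cE; apply: val_inj; rewrite cE.
Qed.

(* Main.v *)
Require Import Defs.
From mathcomp Require Import all_boot all_order all_algebra.
From mathcomp Require Import all_classical all_reals topology.

(* Lower bound: a dense set meets every box prescribing the values at fewer than
   [K] points, so it restricts onto [A^L] for every [L < K]; by Cantor it then
   has at least [K] elements, hence absorbs the sum over the at most [K]
   cardinals below [K].  Upper bound: embed [B] into [2^A]; fewer than [K] points
   are told apart by fewer than [K] coordinates in [A], so the functions reading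
   only the traces of a point on [|L|^2] coordinates are dense, and there are
   only [A^<K] of them. *)

Set Implicit Arguments.
Unset Strict Implicit.
Unset Printing Implicit Defensive.

Local Open Scope classical_set_scope.
Local Open Scope card_scope.

(** * Cardinal arithmetic: exponents, Cantor's theorem, squares of infinite sets *)

Lemma card_leTTP (T U : Type) :
  [set: T] #<= [set: U] <-> exists f : T -> U, injective f.
Proof.
split=> [/card_le_rel[G [GT Ginj]]|[f fI]].
  have /choice[f fP] : forall x, exists y, G x y.
    by move=> x; have [|y _ Gxy] := GT x; [|exists y].
  by exists f => x y fxy; apply: (Ginj _ _ (f x)) => //; rewrite fxy.
apply: (@rel_card_le _ _ _ _ (fun x y => f x = y)) => [x _|x y z _ _ <- /fI//].
by exists (f x).
Qed.

Lemma card_le_funP (T U : Type) (u : U) (A : set T) (B : set U) :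
  A #<= B -> exists f : T -> U, (forall x, A x -> B (f x)) /\
    (forall x y, A x -> A y -> f x = f y -> x = y).
Proof.
move=> /card_le_rel[G [GA Ginj]].
have /choice[f fP] : forall x, exists y, A x -> B y /\ G x y.
  move=> x; have [Ax|nAx] := pselect (A x); last by exists u.
  by have [y By Gxy] := GA x Ax; exists y.
exists f; split=> [x /fP[]//|x y Ax Ay fxy].
have [_ Gx] := fP _ Ax; have [_ Gy] := fP _ Ay.
by apply: Ginj Gx _ => //; rewrite fxy.
Qed.

Lemma card_le_setX (T U T' U' : Type) (A : set T) (B : set U) (A' : set T')
    (B' : set U') :
  A #<= B -> A' #<= B' -> A `*` A' #<= B `*` B'.
Proof.
move=> /card_le_rel[G [GA Gi]] /card_le_rel[H [HA Hi]].
apply: (@rel_card_le _ _ _ _ (fun p q => G p.1 q.1 /\ H p.2 q.2)).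
  move=> [x y] [/= /GA[x' Bx Gx] /HA[y' By Hy]].
  by exists (x', y').
move=> [x y] [x' y'] [u v] /= [Ax Ay] [Ax' Ay'] [Gx Hy] [Gx' Hy'].
by rewrite (Gi _ _ _ Ax Ax' Gx Gx') (Hi _ _ _ Ay Ay' Hy Hy').
Qed.

Lemma card_le_prod (T U T' U' : Type) :
  [set: T] #<= [set: U] -> [set: T'] #<= [set: U'] ->
  [set: T * T'] #<= [set: U * U'].
Proof. by rewrite -!setXTT; exact: card_le_setX. Qed.

(** A function on [T] extends along the injection into [U], with default value [a] off the image,
    and is recovered by restriction. *)
Lemma card_le_fun (T U A : Type) (a : A) :
  [set: T] #<= [set: U] -> [set: T -> A] #<= [set: U -> A].
Proof.
move=> /card_leTTP[f fI]; apply/card_leTTP.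
have [F FP] : exists F : (T -> A) -> U -> A, forall h x, F h (f x) = h x.
  have /choice[g gP] : forall u, exists o, forall x, u = f x -> o = Some x.
    move=> u; have [[x ->]|nx] := pselect (exists x, u = f x).
      by exists (Some x) => y /fI ->.
    by exists None => x ux; case: nx; exists x.
  by exists (fun h u => oapp h a (g u)) => h x; rewrite (gP _ x).
by exists F => h k Fhk; apply/funext => x; rewrite -(FP h) Fhk FP.
Qed.

(** Diagonal argument: [d] marks the codes [f h] at which [h] itself is false, and has no consistent
    value at its own code [f d]. *)
Lemma Cantor_nle (T : Type) : ~~ ([set: T -> bool] #<= [set: T]).
Proof.
apply/negP => /card_leTTP[f fI].
pose d t := `[< exists h, f h = t /\ h t = false >].
case dd : (d (f d)).
  by move: (dd) => /asboolP[h [/fI ->]]; rewrite dd.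
by move: (dd) => /negbT/asboolPn; apply; exists d.
Qed.

(** Hessenberg's theorem, by Zorn's lemma on graphs of injections from the square of a domain [D]
    into [D]. If a maximal [D] were smaller than [T], its complement would contain a copy of [D],
    and the injection would extend to the square of the union of [D] and this copy. *)
Lemma card_le_setM (T : Type) : infinite_set [set: T] ->
  [set: T * T] #<= [set: T].
Proof.
move=> Tinf; have /infiniteP/card_leTTP [e eI] := Tinf.
have /card_leTTP[nn nnI] : [set: nat * nat] #<= [set: nat].
  by have /card_eqPle[] := card_nat2.
(* The countable seed [G0] keeps the maximal domain infinite. Zorn ranges over what is added to it,
   so that the empty chain is bounded too. *)
pose G0 := [set p : T * T * T | exists m n, p = (e m, e n, e (nn (m, n)))].
pose dom (G : set (T * T * T)) := [set x | exists y, G (x, x, y)].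
pose P (G : set (T * T * T)) := [/\
  forall x y z, G (x, y, z) -> [/\ dom G x, dom G y & dom G z],
  forall x y, dom G x -> dom G y -> exists z, G (x, y, z) &
  forall p q, G p -> G q -> (p.1 = q.1 <-> p.2 = q.2)].
have P0 : P G0.
  split.
  - move=> x y z [m [n [-> -> ->]]]; split.
    + by exists (e (nn (m, m))), m, m.
    + by exists (e (nn (n, n))), n, n.
    + by exists (e (nn (nn (m, n), nn (m, n)))), (nn (m, n)), (nn (m, n)).
  - move=> x y [_ [m [_ [-> _ _]]]] [_ [n [_ [-> _ _]]]].
    by exists (e (nn (m, n))), m, n.
  - move=> _ _ [m [n ->]] [m' [n' ->]] /=.
    by split=> [[/eI-> /eI->]|/eI/nnI[-> ->]].
have [F FP Ftot|G [PG Gmax]] := @Zorn_bigcup _ [set G | P (G0 `|` G)].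
  have [[X0 FX0]|F0] := pselect (F !=set0); last first.
    rewrite /= (_ : F = set0) ?bigcup_set0 ?setU0 //.
    by rewrite -subset0 => X FX; apply: F0; exists X.
  pose U := G0 `|` \bigcup_(X in F) X.
  have XU X : F X -> G0 `|` X `<=` U.
    by move=> FX p [?|Xp]; [left|right; exists X].
  have UX p : U p -> exists2 X, F X & (G0 `|` X) p.
    by move=> [G0p|[X FX Xp]]; [exists X0 => //; left|exists X => //; right].
  have U2 p q : U p -> U q -> exists X, [/\ X `<=` U, P X, X p & X q].
    move=> /UX[X FX Xp] /UX[Y FY Yq].
    have [/(@setUS _ G0) XY|/(@setUS _ G0) YX] := Ftot _ _ FX FY.
    - by exists (G0 `|` Y); split=> //; [exact: XU|exact: FP|exact: XY].
    - by exists (G0 `|` X); split=> //; [exact: XU|exact: FP|exact: YX].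
  have domU X x : X `<=` U -> dom X x -> dom U x.
    by move=> XsU [y Xy]; exists y; exact: XsU.
  split.
  - move=> x y z Up; have [X [XsU [XD _ _] Xp _]] := U2 _ _ Up Up.
    by have [? ? ?] := XD _ _ _ Xp; split; exact: (domU X).
  - move=> x y [x' Ux] [y' Uy]; have [X [XsU [_ Xf _] Xx Xy]] := U2 _ _ Ux Uy.
    have [||z Xz] := Xf x y; [by exists x'|by exists y'|].
    by exists z; exact: XsU.
  - move=> p q Up Uq; have [X [_ [_ _ Xi] Xp Xq]] := U2 _ _ Up Uq.
    exact: Xi.
move: PG; set H := G0 `|` G => -[HD Hf Hi].
pose D := dom H.
have eD n : D (e n) by exists (e (nn (n, n))); left; exists n, n.
have Dinf : infinite_set D.
  apply/infiniteP; apply: (@rel_card_le _ _ _ _ (fun n x => e n = x)).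
    by move=> n _; exists (e n).
  by move=> m n x _ _ <- /eI.
have DD : D `*` D #<= D.
  apply: (@rel_card_le _ _ _ _ (fun p y => H (p, y))).
    move=> [x y] [Dx Dy]; have [z Hz] := Hf _ _ Dx Dy.
    by exists z => //; have [] := HD _ _ _ Hz.
  by move=> p q y _ _ Hp Hq; apply/(Hi _ _ Hp Hq).
have [TD|nTD] := boolP ([set: T] #<= D).
  apply: card_le_trans (card_leT D); apply: card_le_trans DD.
  by rewrite -setXTT; exact: card_le_setX.
exfalso.
have DT : D #< [set: T] by rewrite /card_lt card_leT.
(* Otherwise [T] would be the union of two sets smaller than itself. *)
have DnD : D #<= ~` D.
  have [//|nD] := card_le_total D (~` D).
  have nDT : ~` D #< [set: T].
    rewrite /card_lt card_leT; apply: contra nTD => TnD.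
    exact: card_le_trans nD.
  have := card_lt_setU Tinf DT nDT.
  by rewrite setUv /card_lt card_lexx.
have [r [rD rI]] := card_le_funP (e 0%N) DnD.
pose E := D `|` r @` D.
have ED : E #<= D.
  apply: card_le_trans (card_setX_bool Dinf).
  apply: (@rel_card_le _ _ _ _
    (fun x p => D p.1 /\ x = if p.2 then r p.1 else p.1)).
    by move=> x [Dx|[y Dy <-]]; [exists (x, false)|exists (y, true)].
  by move=> x y p _ _ [_ ->] [_ ->].
have EED : E `*` E #<= D by apply: card_le_trans DD; exact: card_le_setX.
have [q [qD qI]] := card_le_funP (e 0%N) EED.
(* The new pairs get values in the copy of [D] under [r]; it is disjoint from [D], so these values
   never collide with those of [H]. *)
pose N := [set p : T * T * T | exists x y,
  [/\ E x, E y, ~ (D x /\ D y) & p = (x, y, r (q (x, y)))]].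
have NN x y : E x -> E y -> ~ (D x /\ D y) -> N (x, y, r (q (x, y))).
  by move=> Ex Ey nD; exists x, y.
have HN : H `|` N = G0 `|` (G `|` N) by rewrite setUA.
apply: (Gmax (G `|` N)).
  split; first by left.
  move=> GNG; have rD0 := rD _ (eD 0%N).
  have Er : E (r (e 0%N)) by right; exists (e 0%N).
  have Hr : H (r (e 0%N), r (e 0%N), r (q (r (e 0%N), r (e 0%N)))).
    by right; apply: GNG; right; apply: NN => // -[].
  by have [] := HD _ _ _ Hr.
rewrite /= -HN.
have domE x : dom (H `|` N) x <-> E x.
  split=> [[y [Hx|[u [v [Eu Ev _ [-> _ _]]]]]]//|Ex].
    by left; exists y.
  have [Dx|nDx] := pselect (D x).
    by case: Dx => y Hx; exists y; left.
  by exists (r (q (x, x))); right; apply: NN => // -[].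
split.
- move=> x y z [/HD[Dx Dy Dz]|[u [v [Eu Ev _ [-> -> ->]]]]].
    by split; apply/domE; left.
  by split; apply/domE => //; right; exists (q (u, v)) => //; exact: qD.
- move=> x y /domE Ex /domE Ey; have [[Dx Dy]|nD] := pselect (D x /\ D y).
    by have [z Hz] := Hf _ _ Dx Dy; exists z; left.
  by exists (r (q (x, y))); right; exact: NN.
- have HNF p p' : H p -> N p' -> p.1 = p'.1 <-> p.2 = p'.2.
    case: p => [[x y] z] /HD[Dx Dy Dz] [u [v [Eu Ev nD ->]]] /=.
    split=> [[xu yv]|zE]; first by case: nD; rewrite -xu -yv.
    by case: (rD (q (u, v))); [exact: qD|rewrite -zE].
  move=> p p' [Hp|Np] [Hp'|Np'].
  + exact: Hi.
  + exact: HNF.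
  + by split=> /esym pp'; apply/esym; apply/(HNF _ _ Hp' Np).
  + case: Np Np' => u [v [Eu Ev _ ->]] [u' [v' [Eu' Ev' _ ->]]] /=.
    split=> [[-> ->]//|/rI quv].
    by apply: qI => //; apply: quv; exact: qD.
Qed.

Lemma card_le_sigT (I : Type) (X : I -> Type) (T : Type) :
  infinite_set [set: T] -> [set: I] #<= [set: T] ->
  (forall i, [set: X i] #<= [set: T]) -> [set: {i & X i}] #<= [set: T].
Proof.
move=> Tinf /card_leTTP[f fI] XT; apply: card_le_trans (card_le_setM Tinf).
have /all_sig[h hI] : forall i, {h : X i -> T | injective h}.
  by move=> i; apply/cid/card_leTTP.
apply/card_leTTP; exists (fun s => (f (projT1 s), h _ (projT2 s))).
by move=> [i x] [j y] /= [/fI ij]; move: ij y => <- y /hI ->.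
Qed.

(** * Well-ordering of cardinals and the number of cardinals below [K] *)

(* A maximal set of pairwise everywhere-distinct choice functions exhausts some
   [F i], which it then injects into every [F j]. *)
Lemma card_le_min (I T : Type) (F : I -> set T) : inhabited I ->
  exists i, forall j, F i #<= F j.
Proof.
move=> [i0].
pose P := [set G : set (I -> T) | (forall g, G g -> forall i, F i (g i)) /\
  (forall g h i, G g -> G h -> g i = h i -> g = h)].
have [Z ZP Ztot|G [[GF Gi] Gmax]] := @Zorn_bigcup _ P.
  split=> [g [X ZX Xg]|g h i [X ZX Xg] [Y ZY Yh]]; first exact: (ZP _ ZX).1.
  have [XY|YX] := Ztot _ _ ZX ZY.
    by apply: (ZP _ ZY).2 => //; exact: XY.
  by apply: (ZP _ ZX).2 => //; exact: YX.
have [[i Gim]|nG] :=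
    pselect (exists i, forall x, F i x -> exists2 g, G g & g i = x).
  exists i => j; apply: (@rel_card_le _ _ _ _
    (fun x y => exists2 g, G g & x = g i /\ y = g j)).
    by move=> x /Gim[g Gg <-]; exists (g j); [exact: GF|exists g].
  by move=> x x' y _ _ [g Gg [-> ->]] [h Gh [-> /(Gi _ _ _ Gg Gh) ->]].
exfalso.
have /choice[g gP] : forall i, exists x, F i x /\ forall h, G h -> h i <> x.
  move=> i; apply: contrapT => nx; apply: nG; exists i => x Fx.
  apply: contrapT => nh; apply: nx; exists x; split=> // h Gh hx.
  by apply: nh; exists h.
apply: (Gmax (g |` G)).
  split; first by move=> h; right.
  by move=> /(_ g (or_introl erefl)) Gg; exact: (gP i0).2 Gg _.
split=> [h [->|/GF//] i|h k i [->|Gh] [->|Gk]//]; first exact: (gP i).1.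
- by move=> /esym /((gP i).2 _ Gk).
- by move=> /((gP i).2 _ Gh).
- exact: Gi.
Qed.

(* The injection is built by recursion: each point is sent outside the image of
   the set of its predecessors. *)
Lemma card_le_init_seg (W T : Type) (lt : W -> W -> Prop) (S : set W)
    (L : set T) : well_founded lt ->
  (forall x y, x <> y -> lt x y \/ lt y x) ->
  (forall w, S w -> ~~ (L #<= [set x | S x /\ lt x w])) -> S #<= L.
Proof.
move=> ltwf lttot SL.
have [[w0 Sw0]|/set0P/negP/negPn/eqP->] := pselect (S !=set0); last first.
  exact: card_ge0.
have [t0 _] : L !=set0.
  by apply/set0P/negP => /eqP L0; have := SL _ Sw0; rewrite L0 card_ge0.
have /choice[pick pickP] : forall X : set T, exists t, X !=set0 -> X t.
  by move=> X; have [[t Xt]|nX] := pselect (X !=set0); [exists t|exists t0].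
pose step w (g : forall x, lt x w -> T) :=
  pick (L `\` [set t | exists x (xw : lt x w), S x /\ t = g x xw]).
pose g := Fix ltwf (fun=> T) step.
have gE w : g w = pick (L `\` g @` [set x | S x /\ lt x w]).
  rewrite /g Fix_eq; last first.
    move=> x u v uv; suff -> : u = v by [].
    by apply: functional_extensionality_dep => y; apply/funext.
  congr (pick (_ `\` _)); apply/seteqP; split=> t /=.
    by move=> [x [xw [Sx ->]]]; exists x.
  by move=> [x [Sx xw] <-]; exists x, xw.
have gP w : S w -> (L `\` g @` [set x | S x /\ lt x w]) (g w).
  move=> Sw; rewrite [X in _ X]gE; apply: pickP; apply: contrapT => nL.
  have /negP := SL w Sw; apply.
  apply: (@rel_card_le _ _ _ _ (fun t x => g x = t)).
    move=> t Lt; apply: contrapT => nt; apply: nL; exists t.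
    by split=> // -[x Sx gx]; apply: nt; exists x.
  by move=> t t' x _ _ <-.
apply: (@rel_card_le _ _ _ _ (fun w t => g w = t)).
  by move=> w Sw; exists (g w) => //; have [] := gP w Sw.
move=> w v _ Sw Sv <- gvw; apply: contrapT => /lttot[wv|vw].
  by have [_] := gP v Sv; apply; exists w.
by have [_] := gP w Sw; apply; exists v.
Qed.

(** Cardinals are well-ordered by size. By induction each [c] has at most [F c] predecessors,
    because the initial segments below it are bounded by smaller cardinals; the same argument then
    applies to [K] itself. *)
Lemma card_cardinals_lt (K : Type) : [set: cardinals_lt K] #<= [set: K].
Proof.
pose F (c : cardinals_lt K) : set K := get (val c).
pose lt c c' := F c #< F c'.
have FK c : F c #< [set: K] by have [] := get_cardinals_lt c.
(* An inaccessible cardinal of least size would have only accessible predecessors. *)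
have ltwf : well_founded lt.
  move=> c; apply: contrapT => nc.
  have [[i ni] imin] := @card_le_min {c | ~ Acc lt c} _ (fun c => F (projT1 c))
    (inhabits (exist _ c nc)).
  apply: (ni); constructor => j ji; apply: contrapT => nj.
  by have := imin (exist _ j nj); move: ji => /andP[_ /negP].
have lttot c c' : c <> c' -> lt c c' \/ lt c' c.
  rewrite /lt /card_lt => cc'.
  have [FF|FF] := boolP (F c #<= F c'); have [FF'|FF'] := boolP (F c' #<= F c).
  - exfalso; apply: cc'; apply: val_inj.
    have [_ ->] := get_cardinals_lt c; have [_ ->] := get_cardinals_lt c'.
    have E : F c #= F c' by rewrite card_eq_le FF.
    by apply/seteqP; split=> M /=; rewrite (card_eqr E).
  - by left.
  - by right.
  - by have [/(negP FF)|/(negP FF')] := card_le_total (F c) (F c').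
have ltF c (X : set (cardinals_lt K)) T (L : set T) :
    F c #< L -> X #<= F c -> ~~ (L #<= X).
  by move=> /andP[_ LF] XF; apply: contra LF => LX; exact: card_le_trans XF.
have seg c : [set x | lt x c] #<= F c.
  elim/(well_founded_ind ltwf): c => c IH.
  apply: (card_le_init_seg ltwf) => // w wc; apply: (ltF w) => //.
  by apply: card_le_trans (IH _ wc); apply: subset_card_le => x [].
apply: (card_le_init_seg ltwf) => // w _; apply: (ltF w) => //.
by apply: card_le_trans (seg w); apply: subset_card_le => x [].
Qed.

(** * Bounds for the sum of the powers of [A] with exponents below [K] *)

Section pow_lt_card.
Context (A K : Type) (a0 a1 : A) (a01 : a0 <> a1).
Context (infK : infinite_set [set: K]).

Lemma card_le_fun_bool (L : Type) : [set: L -> bool] #<= [set: L -> A].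
Proof.
apply/card_leTTP; exists (fun f l => if f l then a1 else a0) => f g fg.
apply/funext => l; move/(congr1 (@^~ l)): fg.
by case: (f l) (g l) => -[] // /esym; move/a01.
Qed.

(** The bound is assumed only for the representatives [get (val c)]; any exponent smaller than [K]
    is equipotent to one of them. *)
Lemma card_le_fun_lt (L : Type) (T : Type) :
  (forall c : cardinals_lt K,
    [set: (get (val c) : set K) -> A] #<= [set: T]) ->
  [set: L] #< [set: K] -> [set: L -> A] #<= [set: T].
Proof.
move=> AT /cardinals_lt_unique[c [Lc _]]; apply: card_le_trans (AT c).
apply: (card_le_fun a0).
by move: Lc; rewrite card_eq_le => /andP[/card_le_trans + _]; apply;
  rewrite (card_le_eqr (card_setT _)).
Qed.

(** If [T] were smaller than [K], it would itself be an admissible exponent, and [T -> bool] would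
    embed into [T -> A], hence into [T], against Cantor. *)
Lemma card_le_pow_lt (T : Type) :
  (forall c : cardinals_lt K,
    [set: (get (val c) : set K) -> A] #<= [set: T]) ->
  [set: K] #<= [set: T].
Proof.
move=> AT; have [KT|nKT] := boolP ([set: K] #<= [set: T]) => //.
have TK : [set: T] #< [set: K].
  rewrite /card_lt nKT andbT.
  by have [|//] := card_le_total [set: K] [set: T]; rewrite (negPf nKT).
have /negP[] := Cantor_nle T.
exact: card_le_trans (card_le_fun_bool T) (card_le_fun_lt AT TK).
Qed.

(** The sum has at most [K] terms and [T] is at least [K], hence infinite, so a bound on each term
    bounds the sum. *)
Lemma pow_lt_card_le (T : Type) :
  (forall c : cardinals_lt K,
    [set: (get (val c) : set K) -> A] #<= [set: T]) ->
  [set: pow_lt A K] #<= [set: T].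
Proof.
move=> AT; have KT := card_le_pow_lt AT.
apply: card_le_sigT => //; last exact: card_le_trans (card_cardinals_lt K) KT.
by apply/infiniteP; apply: card_le_trans KT; exact/infiniteP.
Qed.

Lemma card_le_pow_lt_fun (c : cardinals_lt K) :
  [set: (get (val c) : set K) -> A] #<= [set: pow_lt A K].
Proof.
apply/card_leTTP; exists (fun h => existT _ c h) => h k e.
by have := projT2_eq e; rewrite (Prop_irrelevance (projT1_eq e) erefl).
Qed.

Lemma infinite_pow_lt : infinite_set [set: pow_lt A K].
Proof.
apply/infiniteP; apply: card_le_trans (card_le_pow_lt card_le_pow_lt_fun).
exact/infiniteP.
Qed.

End pow_lt_card.

(** An infinite [L] absorbs its square; a finite one, the only case when [K] is countable, has a
    finite square. *)
Lemma card_lt_setM (K L : Type) : infinite_set [set: K] ->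
  [set: L] #< [set: K] -> [set: L * L] #< [set: K].
Proof.
move=> Kinf LK; have [Lfin|Linf] := pselect (finite_set [set: L]).
  have LLfin : finite_set [set: L * L] by rewrite -setXTT; exact: finite_setX.
  have KLL : ~~ ([set: K] #<= [set: L * L]).
    by apply/negP => /card_le_finite/(_ LLfin).
  rewrite /card_lt KLL andbT.
  by have [//|] := card_le_total [set: L * L] [set: K]; rewrite (negPf KLL).
have LL := card_le_setM Linf.
move/andP: LK => [LK KL]; apply/andP; split; first exact: card_le_trans LL LK.
by apply: contra KL => KLL; exact: card_le_trans LL.
Qed.

(** * Dense subsets of the [K]-box power of a discrete space *)

Section kbox_density.
Context (A B K : Type) (infK : [set: nat] #<= [set: K]).
Context (a0 a1 : A) (a01 : a0 <> a1).

Let X := kbox_product infK (fun _ : B => discrete_topology {classic A}).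

(** Points are open in the factors, so prescribing [f] on [S] is a box; conversely a box around [f]
    contains every function agreeing with [f] on its support. *)
Lemma dense_kboxP (D : set X) : dense D <-> forall (S : set B) (f : X),
  S #< [set: K] -> exists2 g, D g & forall b, S b -> g b = f b.
Proof.
split=> [Ddense S f SK|DS O [f Of] /kbox_openE[F FK FO]].
  pose U b : set (discrete_topology {classic A}) := [set a | S b -> a = f b].
  have Uf : (kbox U : set X) f by move=> b.
  have [|g [gU Dg]] := Ddense (kbox U : set X) (ex_intro _ f Uf).
    apply/kbox_openE; exists [set U]; last by rewrite bigcup_set1.
    move=> _ ->; split; first by move=> b; exact: discrete_open.
    have US : [set b | U b <> setT] #<= S.
      apply: subset_card_le => b; apply: contra_notP => nSb.
      by apply/seteqP; split=> // a _ /nSb.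
    move/andP: SK => [SK KS]; apply/andP; split; first exact: card_le_trans SK.
    by apply: contra KS => KU; exact: card_le_trans US.
  by exists g => // b; exact: gU.
move: Of; rewrite -FO => -[U FU Uf].
have [g Dg gf] := DS _ f (FK _ FU).2.
exists g; split=> //; exists U => // b.
have [->//|Ub] := pselect (U b = setT).
by rewrite gf.
Qed.

Lemma dense_kbox_ge (D : set X) : [set: K] #<= [set: B] -> dense D ->
  [set: pow_lt A K] #<= D.
Proof.
move=> KB /dense_kboxP Ddense; have Kinf := (infiniteP _).2 infK.
suff : [set: pow_lt A K] #<= [set: D] by rewrite (card_le_eqr (card_setT _)).
apply: (pow_lt_card_le a01) => // c.
set L : set K := get (val c).
have /andP[LK KL] : L #< [set: K] by have [] := get_cardinals_lt c.
have /card_leTTP[e eI] : [set: L] #<= [set: B].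
  by rewrite (card_le_eql (card_setT _)); exact: card_le_trans LK KB.
have eK : range e #< [set: K].
  have eL : range e #<= L.
    by rewrite -(card_le_eqr (card_setT L)); exact: card_image_le.
  apply/andP; split; first exact: card_le_trans LK.
  by apply: contra KL => Ke; exact: card_le_trans eL.
(* Each [h] is transported to the small set [range e] and realised there by a member of [D]; this
   choice is injective since [h] is recovered from it. *)
have /choice[g gP] : forall h : L -> A,
    exists g : D, forall l, val g (e l) = h l.
  move=> h.
  have /choice[f fP] : forall b, exists a, forall l, e l = b -> h l = a.
    move=> b; have [[l <-]|nb] := pselect (exists l, e l = b).
      by exists (h l) => l' /eI ->.
    by exists a0 => l lb; case: nb; exists l.
  have [g Dg gf] := Ddense _ f eK.
  by exists (SigSub (mem_set Dg)) => l; rewrite /= gf//; exact/esym/fP.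
apply/card_leTTP; exists g => h k gg.
by apply/funext => l; rewrite -!gP gg.
Qed.

(* A code lists [|L|^2] coordinates, then for each [l] in [L] a trace on them
   ([q |-> (s.1.2 ((l, l), q) == a1)]) and the value taken at the points of [B]
   having that trace.  The pairs [(l, l)] only serve to reuse [card_lt_setM]. *)
Lemma dense_kbox_le : [set: B] #<= [set: A -> bool] ->
  exists2 D : set X, dense D & D #<= [set: pow_lt A K].
Proof.
move=> /card_leTTP[j jI]; have Kinf := (infiniteP _).2 infK.
pose code (c : cardinals_lt K) : Type := let L : set K := get (val c) in
  ((L * L -> A) * ((L * L) * (L * L) -> A) * (L -> A))%type.
pose near c (s : code c) b l :=
  forall q, j b (s.1.1 q) = (s.1.2 ((l, l), q) == a1 :> {classic A}).
(* The value at [b] is constrained only when exactly one [l] has the trace of [b]; [a0] is the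
   default when none has. *)
have /choice[dec decP] : forall sb : {c & code c} * B, exists a,
    forall l, near _ (projT2 sb.1) sb.2 l ->
    (forall l', near _ (projT2 sb.1) sb.2 l' -> l' = l) ->
    a = (projT2 sb.1).2 l.
  move=> [[c s] b] /=; have [[l sl]|nl] := pselect (exists l, near c s b l).
    by exists (s.2 l) => l' sl' /(_ l sl) ->.
  by exists a0 => l sl; case: nl; exists l.
exists (range (fun s => (fun b => dec (s, b)) : X)); last first.
  apply: card_le_trans (card_image_le _ _) _.
  have Pinf := infinite_pow_lt a01 Kinf.
  apply: card_le_sigT => // [|c].
    apply: card_le_trans (card_cardinals_lt K) _.
    exact: card_le_pow_lt a01 _ (@card_le_pow_lt_fun A K).
  have LK : [set: (get (val c) : set K)] #< [set: K].
    have [+ _] := get_cardinals_lt c.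
    by rewrite /card_lt (card_le_eql (card_setT _)) (card_le_eqr (card_setT _)).
  have LLK := card_lt_setM Kinf LK; have LLLK := card_lt_setM Kinf LLK.
  have P := card_le_fun_lt a0 (@card_le_pow_lt_fun A K).
  apply: card_le_trans (card_le_setM Pinf); apply: card_le_prod (P _ LK).
  apply: card_le_trans (card_le_setM Pinf).
  exact: card_le_prod (P _ LLK) (P _ LLLK).
apply/dense_kboxP => S f SK.
have [c [/card_esym/card_bijP[e [e' eK e'K]] _]] := cardinals_lt_unique SK.
(* [sep q] is a coordinate separating the two points of [S] indexed by [q], available by injectivity
   of [j] when they differ. *)
have /choice[sep sepP] : forall q, exists a, val (e q.1) <> val (e q.2) ->
    j (val (e q.1)) a <> j (val (e q.2)) a.
  move=> q; have [[a ja]|nj] :=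
    pselect (exists a, j (val (e q.1)) a <> j (val (e q.2)) a).
    by exists a.
  exists a0 => ne; case: ne; apply: jI; apply/funext => a.
  by apply: contrapT => ja; apply: nj; exists a.
(* The bits of a trace are stored as [a1] for true and [a0] for false, so that a code consists of
   functions into [A]. *)
pose s : code c := (sep,
  fun r => if j (val (e r.1.1)) (sep r.2) then a1 else a0,
  fun l => f (val (e l))).
exists (fun b => dec (existT _ c s, b)); first by exists (existT _ c s).
move=> b Sb; pose l := e' (SigSub (mem_set Sb)).
have el : val (e l) = b by rewrite /l e'K.
have nearE l' : near c s b l' <->
    forall q, j b (sep q) = j (val (e l')) (sep q).
  have E q : (s.1.2 ((l', l'), q) == a1 :> {classic A}) =
      j (val (e l')) (sep q).
    by rewrite /=; case: ifP => _; [rewrite eqxx|apply/eqP].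
  by split=> + q => /(_ q); rewrite E.
rewrite (decP (existT _ c s, b) l) /= ?el//.
  by apply/nearE => q; rewrite el.
(* Equal traces agree in particular at the coordinate separating [l] from [l']. *)
move=> l' /nearE/(_ (l, l')); rewrite -{1}el => /esym ll'.
apply: contrapT => ne; apply: (sepP (l, l')) => //=.
by move=> /val_inj/(can_inj eK) /esym.
Qed.

End kbox_density.

Theorem theorem4p17 (A B K : Type)
  (infK : [set: nat] #<= [set: K])
  (leKB : [set: K] #<= [set: B])
  (leB2A : [set: B] #<= [set: A -> bool]) :
  is_density
    (kbox_product infK (fun _ : B => discrete_topology {classic A}))
    [set: pow_lt A K].
Proof.
(* With at most one point in [A], a predicate on [A] is determined by whether it holds somewhere, so
   [A -> bool] would embed into [bool], yet it dominates [nat]. *)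
have [a0 [a1 a01]] : exists a0 a1 : A, a0 <> a1.
  apply: contrapT => nA.
  have A1 (a a' : A) : a = a'.
    by apply: contrapT => aa'; apply: nA; exists a, a'.
  have /infiniteP : [set: nat] #<= [set: bool].
    apply: card_le_trans infK _; apply: card_le_trans leKB _.
    apply: card_le_trans leB2A _; apply/card_leTTP.
    exists (fun f => `[< exists a, f a >]) => f g fgE.
    have fg : (exists a, f a) <-> (exists a, g a).
      by split=> /asboolP; [rewrite fgE|rewrite -fgE] => /asboolP.
    apply/funext => a; apply/idP/idP => [fa|ga].
      by have [a' ga'] := fg.1 (ex_intro _ a fa); rewrite (A1 a a').
    by have [a' fa'] := fg.2 (ex_intro _ a ga); rewrite (A1 a a').
  by apply; exact: finite_finset.
have [D Ddense DP] := dense_kbox_le infK a01 leB2A.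
split; last by move=> D'; exact: (dense_kbox_ge a01).
by exists D => //; rewrite card_eq_le DP (dense_kbox_ge a01).
Qed.
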